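(* Let $\boldsymbol{a}\in\mathbb{Z}^\omega$ be a thick sequence of integers. Then $$H=\mathsf{H}_{\boldsymbol{a}}(\mathcal{J}_{H,\boldsymbol{a}})$$ for each subgroup $H$ of $\mathbb{T}$.
   Context: $\omega=\{0,1,2,\dots\}$; $\mathbb{T}=\mathbb{R}/\mathbb{Z}$; $\|x\|:=\min\{|x-z|:z\in\mathbb{Z}\}$. A sequence $\boldsymbol{a}=(a_n:n\in\omega)\in\mathbb{Z}^\omega$ is thick if $\mathrm{ran}(\boldsymbol{a}):=\{a_n:n\in\omega\}$ contains arbitrarily large (arbitrarily long finite) intervals of integers. For $\alpha\in\mathbb{T}$ and $\varepsilon>0$ put $N_{\boldsymbol{a}}(\alpha,\varepsilon):=\{n\in\mathrm{ran}(\boldsymbol{a}):\|n\alpha\|\ge\varepsilon\}$. For a subgroup $H$ of $\mathbb{T}$, $\mathcal{I}_{H,\boldsymbol{a}}$ is the ideal on $\mathrm{ran}(\boldsymbol{a})$ generated by the sets $N_{\boldsymbol{a}}(\alpha,\varepsilon)$ with $\alpha\in H$, $\varepsilon>0$, i.e. the family of all $S\subseteq\mathrm{ran}(\boldsymbol{a})$ contained in the union of a finite subset of $\mathrm{ran}(\boldsymbol{a})$ and finitely many such sets $N_{\boldsymbol{a}}(\alpha,\varepsilon)$. Then $\mathcal{J}_{H,\boldsymbol{a}}:=\{S\subseteq\omega:\{a_n:n\in S\}\in\mathcal{I}_{H,\boldsymbol{a}}\}$; it is a (proper) ideal on $\omega$ containing all finite sets. For an ideal $\mathcal{I}$ on $\omega$,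 $\mathsf{H}_{\boldsymbol{a}}(\mathcal{I}):=\{x\in\mathbb{T}:\{n\in\omega:\|a_nx\|\ge\varepsilon\}\in\mathcal{I}\text{ for all }\varepsilon>0\}$. *)

(* Defs.v *)
From HB Require Import structures.
From mathcomp Require Import all_boot all_order all_algebra.
From mathcomp Require Import ring_quotient.
From mathcomp Require Import all_classical all_reals.

Set Implicit Arguments.
Unset Strict Implicit.
Unset Printing Implicit Defensive.

Import Order.TTheory GRing.Theory Num.Theory.

Local Open Scope classical_set_scope.
Local Open Scope ring_scope.

Section Torus.
Context {R : realType}.

(* R / Z: [Num.int_num_subdef] is the predicate underlying [Num.int], i.e. the
   image of int in R. The additive group structure is the quotient one. *)
Definition torus := Quotient.quot (GRing.ZmodClosed.clone R Num.int_num_subdef _).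

HB.instance Definition _ := GRing.Zmodule.on torus.
HB.instance Definition _ := ZmodQuotient.on torus.

(* The infimum is a minimum: see [dist_int_attained]. *)
Definition dist_int (x : R) : R := inf [set `|x - z%:~R| | z in [set: int]].

(* Independent of the representative: see [tnorm_pi]. *)
Definition tnorm (x : torus) : R := dist_int (repr x).

Lemma torus_eqP (x y : R) :
  reflect (exists z : int, x = y + z%:~R) (x == y %[mod torus])%qT.
Proof.
rewrite -Quotient.idealrBE.
apply: (iffP (@intrP R (x - y))) => -[z xyz]; exists z.
  by rewrite -xyz addrC subrK.
by rewrite xyz [y + _]addrC addrK.
Qed.

Lemma dist_int_attained (x : R) :
  (exists z : int, dist_int x = `|x - z%:~R|) /\
  (forall z : int, dist_int x <= `|x - z%:~R|).
Proof.
have lb0 : lbound [set `|x - z%:~R| | z in [set: int]] 0.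
  by move=> _ [z _ <-]; exact: normr_ge0.
have lb z : dist_int x <= `|x - z%:~R|.
  by apply: ge_inf; [exists 0 | exists z].
split=> //.
set f := Num.floor x.
have fx : f%:~R <= x by exact: floor_le.
have xf : x <= (f + 1)%:~R by rewrite ltW // floorD1_gt.
pose d := Num.min `|x - f%:~R| `|x - (f + 1)%:~R|.
have dlb : d <= dist_int x.
  apply: lb_le_inf; first by exists `|x - f%:~R|, f.
  move=> _ [z _ <-]; rewrite /d ge_min.
  have [zf|fz] := leP z f.
    have zfR : z%:~R <= f%:~R :> R by rewrite ler_int.
    by apply/orP; left; rewrite !ger0_norm ?subr_ge0 ?(le_trans zfR) // lerB.
  have fzR : (f + 1)%:~R <= z%:~R :> R by rewrite ler_int lezD1.
  apply/orP; right.
  have xz := le_trans xf fzR.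
  by rewrite !ler0_norm ?subr_le0 // lerN2 lerB.
move: dlb; rewrite /d; case: (leP `|x - f%:~R|) => _ dlb; [exists f | exists (f + 1)];
  by apply/eqP; rewrite eq_le lb dlb.
Qed.

Lemma tnorm_pi (x : R) : tnorm (\pi_torus x)%qT = dist_int x.
Proof.
rewrite /tnorm.
have /torus_eqP[w ->] : (repr (\pi_torus x) == x %[mod torus])%qT.
  by rewrite reprK.
congr inf; apply/seteqP; split=> _ [z _ <-].
  by exists (z - w) => //; rewrite intrD intrN opprB addrA.
by exists (z + w) => //; rewrite intrD opprD addrACA subrr addr0.
Qed.

End Torus.

Arguments torus : clear implicits.

Section Ideals.
Context {R : realType}.
Implicit Types (a : nat -> int) (H : set (torus R)).

Definition thick a : Prop :=
  forall k : nat, exists m : int,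
    forall i : int, m <= i < m + k%:Z -> range a i.

Definition Nset a (alpha : torus R) (eps : R) : set int :=
  [set n | range a n /\ eps <= tnorm (alpha *~ n)].

Definition Iideal H a : set (set int) :=
  [set S | S `<=` range a /\
    exists (F : set int) (P : set (torus R * R)),
      [/\ finite_set F, F `<=` range a, finite_set P,
          (forall p, P p -> H p.1 /\ 0 < p.2) &
          S `<=` F `|` \bigcup_(p in P) Nset a p.1 p.2]].

Definition Jideal H a : set (set nat) :=
  [set S | Iideal H a [set a n | n in S]].

Definition Hsub a (I : set (set nat)) : set (torus R) :=
  [set x | forall eps : R, 0 < eps -> I [set n | eps <= tnorm (x *~ a n)]].

End Ideals.

(* Main.v *)
Require Import Defs.
From HB Require Import structures.
From mathcomp Require Import all_boot all_order all_algebra.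
From mathcomp Require Import ring_quotient.
From mathcomp Require Import all_classical all_reals.
From mathcomp Require Import topology normedtype sequences trigo.
From mathcomp Require Import ring lra zify.
Set Implicit Arguments.
Unset Strict Implicit.
Unset Printing Implicit Defensive.
Import Order.TTheory GRing.Theory Num.Theory.
Import numFieldNormedType.Exports.
Local Open Scope classical_set_scope.
Local Open Scope ring_scope.

(** A point [x] of [H] lies in the right-hand side because the set of indices
    that its membership requires to be small is, through [a], one of the
    generators [Nset a x e]. The content is the converse. Let [x] lie in the
    right-hand side and suppose that [x] is not in [H]. Taking [e := 1 / 8]
    yields finitely many [t_j] in [H] and [e_j > 0], and a finite set [F], such
    that every [n] in [range a] outside [F] with [tnorm (t_j *~ n) < e_j] for
    all [j] satisfies [tnorm (x *~ n) < 1 / 8]. As [range a] contains intervals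
    of any length, this is refuted by [off_subgroup_escape]: every sufficiently
    long interval of integers contains some [n] outside [F] with all
    [t_j *~ n] small but [x *~ n] far from 0.

    That is a quantitative form of Kronecker's theorem on simultaneous
    approximation, proved by averaging over intervals, without duality or
    compactness. Let [K n := \prod_j (1 + cos (2 pi n t_j)) / 2], which lies in
    [0, 1].
    - For every [N], [K n ^ N * cos (2 pi n x)] is a combination of cosines
      whose frequencies lie in [x + H], hence are nonzero. So its sums over
      intervals are bounded ([orthogonal_off_rieszX]).
    - Where some [t_j *~ n] is not small, [K n <= q] for a fixed [q < 1]
      ([raised_cos_gap]), so [K n ^ N <= q ^ N] there.
    - With [Q := (1 + q) / 2 > q], the set where [K >= Q] meets every interval
      of some fixed length [D] ([riesz_syndetic]), so the sum of [K ^ N] over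
      [l] consecutive such intervals is at least [l * Q ^ N].
    If an interval had no such [n], then [cos (2 pi n x)] would be at least
    [c := cos (pi / 4) > 0] at each of its points outside [F] where all
    [t_j *~ n] are small. The sum of [K n ^ N * cos (2 pi n x)] over the
    interval, of length [l * D], would be at least
    [l * (c * Q ^ N - 2 * D * q ^ N) - 2 * #|F|]. As [Q > q], the coefficient of
    [l] is positive for a suitable [N], and then the sum is unbounded in [l]. *)

(** * Cosine and sine on the torus *)

Lemma periodicz (U V : zmodType) (f : U -> V) (T : U) :
  periodic f T -> forall (k : int) (r : U), f (r + T *~ k) = f r.
Proof.
move=> fT [] k r; first exact: periodicn.
by rewrite NegzE -[in RHS](subrK (T *+ k.+1) r) periodicn // mulrNz.
Qed.

Section TorusCharacter.
Context {R : realType}.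
Implicit Types (t u x : torus R) (m n : int).

Definition tcos t : R := cos (repr t * (pi *+ 2)).
Definition tsin t : R := sin (repr t * (pi *+ 2)).

Lemma tcos_pi (x : R) : tcos (\pi x)%qT = cos (x * (pi *+ 2)).
Proof.
have /torus_eqP[w xw] : (repr (\pi_(torus R) x) == x %[mod torus R])%qT.
  by rewrite reprK.
by rewrite /tcos xw mulrDl mulrzl periodicz //; exact: cosD2pi.
Qed.

Lemma tsin_pi (x : R) : tsin (\pi x)%qT = sin (x * (pi *+ 2)).
Proof.
have /torus_eqP[w xw] : (repr (\pi_(torus R) x) == x %[mod torus R])%qT.
  by rewrite reprK.
by rewrite /tsin xw mulrDl mulrzl periodicz //; exact: sinD2pi.
Qed.

Lemma reprB t u : t - u = (\pi_(torus R) (repr t - repr u)%R)%qT.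
Proof. by rewrite -[in LHS](reprK t) -[in LHS](reprK u) -raddfB. Qed.

Lemma tcosB t u : tcos (t - u) = tcos t * tcos u + tsin t * tsin u.
Proof. by rewrite reprB tcos_pi mulrBl cosB. Qed.

Lemma tsinB t u : tsin (t - u) = tsin t * tcos u - tcos t * tsin u.
Proof. by rewrite reprB tsin_pi mulrBl sinB. Qed.

Lemma tcos0 : tcos 0 = 1.
Proof. by rewrite -(subrr 0) tcosB -!expr2 cos2Dsin2. Qed.

Lemma tsin0 : tsin 0 = 0.
Proof. by rewrite -(subrr 0) tsinB mulrC subrr. Qed.

Lemma tcosN t : tcos (- t) = tcos t.
Proof. by rewrite -sub0r tcosB tcos0 tsin0 mul1r mul0r addr0. Qed.

Lemma tsinN t : tsin (- t) = - tsin t.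
Proof. by rewrite -sub0r tsinB tcos0 tsin0 mul1r mul0r sub0r. Qed.

Lemma tcosD t u : tcos (t + u) = tcos t * tcos u - tsin t * tsin u.
Proof. by rewrite -[u in LHS]opprK tcosB tcosN tsinN mulrN. Qed.

Lemma tcos2Dtsin2 t : tcos t ^+ 2 + tsin t ^+ 2 = 1.
Proof. exact: cos2Dsin2. Qed.

Lemma tnorm_ge0 t : 0 <= tnorm t.
Proof. by rewrite /tnorm; have [[z ->] _] := dist_int_attained (repr t). Qed.

Lemma tnorm_le_half t : tnorm t <= 1 / 2.
Proof.
rewrite /tnorm; set x := repr t.
have [_ lb] := dist_int_attained x.
have := lb (Num.floor x); have := lb (Num.floor x + 1).
have := floor_le x; have := floorD1_gt x; rewrite intrD /=.
set f := (Num.floor x)%:~R => xf fx.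
by rewrite ler0_norm ?ger0_norm; lra.
Qed.

Lemma tnorm_gt0 t : t != 0 -> 0 < tnorm t.
Proof.
move=> t0; rewrite lt_neqAle tnorm_ge0 andbT eq_sym.
apply: contra t0 => /eqP; rewrite /tnorm.
have [[z ->] _] := dist_int_attained (repr t).
move/eqP; rewrite normr_eq0 subr_eq0 => /eqP tz.
have <- : (\pi_(torus R) 0)%qT = 0 by rewrite raddf0.
by rewrite -[t]reprK; apply/torus_eqP; exists z; rewrite add0r.
Qed.

(** [cos] is even and [2 pi]-periodic, so [tcos t] is a decreasing function of
    [tnorm t], which ranges over [[0, 1 / 2]]. *)
Lemma tcos_tnorm t : tcos t = cos (tnorm t * (pi *+ 2)).
Proof.
rewrite /tnorm; have [[z ->] _] := dist_int_attained (repr t).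
have pi2 : 0 <= pi *+ 2 :> R by rewrite mulrn_wge0 // pi_ge0.
rewrite -[X in _ * X]ger0_norm // -normrM cos_norm mulrBl -mulNr -intrN mulrzl.
by rewrite periodicz //; exact: cosD2pi.
Qed.

Lemma ler_cos2pi (e f : R) : 0 <= e -> e <= f -> f <= 1 / 2 ->
  cos (f * (pi *+ 2)) <= cos (e * (pi *+ 2)).
Proof.
move=> e0 ef f1; have p0 := pi_ge0 R.
have e2 : e * (pi *+ 2) \in `[0, pi] by rewrite in_itv /= mulr2n; nra.
have f2 : f * (pi *+ 2) \in `[0, pi] by rewrite in_itv /= mulr2n; nra.
by rewrite leNgt ltr_cos // -leNgt ler_wpM2r // mulrn_wge0.
Qed.

Lemma cos2pi_lt1 (e : R) : 0 < e -> e <= 1 / 2 -> cos (e * (pi *+ 2)) < 1.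
Proof.
move=> e0 e1; have p0 := pi_gt0 R.
have e2 : e * (pi *+ 2) \in `[0, pi] by rewrite in_itv /= mulr2n; nra.
have z2 : 0 \in `[0, pi : R] by rewrite in_itv /= lexx ltW.
by rewrite -cos0 ltr_cos // mulr_gt0 // mulrn_wgt0.
Qed.

Lemma tcos_lt1 t : t != 0 -> tcos t < 1.
Proof.
by move=> t0; rewrite tcos_tnorm cos2pi_lt1 ?tnorm_gt0 ?tnorm_le_half.
Qed.

End TorusCharacter.

(** * Sums over intervals of integers and Riesz products *)

Section BoundedSums.
Context {R : realType}.
Implicit Types (t u x : torus R) (m n : int) (L : nat) (g h : int -> R).

Definition isum g m L : R := \sum_(i < L) g (m + i%:Z).

Definition bounded_sums g := exists C : R, forall m L, `|isum g m L| <= C.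

Lemma isum0 g m : isum g m 0 = 0. Proof. exact: big_ord0. Qed.

Lemma isumSr g m L : isum g m L.+1 = isum g m L + g (m + L%:Z).
Proof. exact: big_ord_recr. Qed.

Lemma isumD g m L1 L2 : isum g m (L1 + L2) = isum g m L1 + isum g (m + L1%:Z) L2.
Proof.
elim: L2 => [|L2 IH]; first by rewrite addn0 isum0 addr0.
by rewrite addnS !isumSr IH -!addrA -PoszD.
Qed.

Lemma eq_bounded_sums g h : g =1 h -> bounded_sums g -> bounded_sums h.
Proof. by move=> /funext ->. Qed.

Lemma bounded_sums_lin (a b : R) g h :
  bounded_sums g -> bounded_sums h -> bounded_sums (fun n => a * g n + b * h n).
Proof.
move=> [C gC] [D hD]; exists (`|a| * C + `|b| * D) => m L.
rewrite /isum big_split -!mulr_sumr /=.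
rewrite (le_trans (ler_normD _ _)) // !normrM.
by apply: lerD; rewrite ler_wpM2l //; [exact: gC | exact: hD].
Qed.

(** Multiplied by [2 - 2 * tcos t], which is nonzero, the sum telescopes. The
    bound does not depend on the position of the interval. *)
Lemma tcos_bounded_sums t : t != 0 -> bounded_sums (fun n => tcos (t *~ n)).
Proof.
move=> t0; set c := tcos t; have c1 : c < 1 by exact: tcos_lt1.
pose h n := tcos (t *~ (n - 1)) - tcos (t *~ n).
have tele m L : (2 - 2 * c) * isum (fun n => tcos (t *~ n)) m L = h (m + L%:Z) - h m.
  elim: L => [|L IH]; first by rewrite isum0 mulr0 addr0 subrr.
  rewrite isumSr mulrDr IH -[L.+1]addn1 PoszD addrA.
  rewrite [LHS]addrAC; congr (_ + _); move: (m + L%:Z) => n.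
  rewrite /h addrK mulrzBr mulrzDr mulr1z tcosB tcosD -/c.
  by ring.
have hb n : `|h n| <= 2.
  by rewrite (le_trans (ler_normB _ _)) // [2]/(1 + 1) lerD // cos_max.
exists (4 / (2 - 2 * c)) => m L.
rewrite ler_pdivlMr; last by lra.
rewrite -[X in _ * X]ger0_norm; last by lra.
rewrite -normrM mulrC tele (le_trans (ler_normB _ _)) //.
by have := hb (m + L%:Z); have := hb m; lra.
Qed.

(** The square of the cosine of half the angle: it takes values in [[0, 1]], is 1
    exactly at 0, and only has the frequencies 0 and [+-t]. *)
Definition raised_cos t : R := (1 + tcos t) / 2.

Lemma raised_cos_ge0 t : 0 <= raised_cos t.
Proof. by rewrite /raised_cos; have := cos_geN1 (repr t * (pi *+ 2)); rewrite -/(tcos t); lra. Qed.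

Lemma raised_cos_le1 t : raised_cos t <= 1.
Proof. by rewrite /raised_cos; have := cos_le1 (repr t * (pi *+ 2)); rewrite -/(tcos t); lra. Qed.

Definition riesz (s : seq (torus R)) n : R := \prod_(t <- s) raised_cos (t *~ n).

Lemma riesz_cons t s n : riesz (t :: s) n = raised_cos (t *~ n) * riesz s n.
Proof. exact: big_cons. Qed.

Lemma riesz_ge0 s n : 0 <= riesz s n.
Proof. by apply: prodr_ge0 => t _; exact: raised_cos_ge0. Qed.

Lemma riesz_le1 s n : riesz s n <= 1.
Proof.
elim: s => [|t s IH]; first by rewrite /riesz big_nil.
by rewrite riesz_cons mulr_ile1 ?raised_cos_ge0 ?riesz_ge0 ?raised_cos_le1.
Qed.

Lemma riesz_le_raised_cos s n t : t \in s -> riesz s n <= raised_cos (t *~ n).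
Proof.
elim: s => // u s IH; rewrite inE riesz_cons => /predU1P[->|/IH le].
  by rewrite ler_piMr ?raised_cos_ge0 ?riesz_le1.
by rewrite (le_trans _ le) // ler_piMl ?riesz_ge0 ?raised_cos_le1.
Qed.

Section OffSubgroup.
Variable H : set (torus R).
Hypothesis subgroup_H : zmod_closed [in H].

Let HB t u : H t -> H u -> H (t - u).
Proof. by move=> tH uH; apply/set_mem/subgroup_H.2; exact: mem_set. Qed.

(** This stands for: all frequencies of [g] lie in [H]. Testing [g] against the
    cosines with frequencies off [H] lets the property pass through products
    without expanding [g] as a trigonometric sum. *)
Definition orthogonal_off g :=
  forall x, ~ H x -> bounded_sums (fun n => g n * tcos (x *~ n)).

Lemma orthogonal_off1 : orthogonal_off (fun=> 1).
Proof.
move=> x Hx; apply: (@eq_bounded_sums (fun n => tcos (x *~ n))) => [n|].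
  by rewrite mul1r.
apply: tcos_bounded_sums; apply: contra_notN Hx => /eqP ->.
exact/set_mem/subgroup_H.1.
Qed.

(** Multiplication by [raised_cos (t *~ n)] replaces the frequency [x] by a
    combination of [x], [x + t] and [x - t], which all stay off [H]. *)
Lemma orthogonal_off_raised_cos g t :
  H t -> orthogonal_off g -> orthogonal_off (fun n => raised_cos (t *~ n) * g n).
Proof.
move=> tH og x Hx.
have Hxt : ~ H (x + t) by move=> /HB /(_ tH); rewrite addrK.
have Hxt' : ~ H (x - t).
  move=> xtH; apply: Hx; rewrite -[x](subrK t) -[t in _ + t]opprK; apply: (HB xtH).
  by rewrite -sub0r; apply: HB tH; exact/set_mem/subgroup_H.1.
have := bounded_sums_lin (1 / 2) (1 / 4) (og _ Hx)
  (bounded_sums_lin 1 1 (og _ Hxt) (og _ Hxt')).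
apply: eq_bounded_sums => n.
by rewrite mulrzDl mulrzBl tcosD tcosB /raised_cos; field.
Qed.

Lemma orthogonal_off_rieszX s N : (forall t, t \in s -> H t) ->
  orthogonal_off (fun n => riesz s n ^+ N).
Proof.
move=> sH.
have mulK g : orthogonal_off g -> orthogonal_off (fun n => riesz s n * g n).
  elim: s sH => [|t s IH] sH og.
    by move=> x /og; apply: eq_bounded_sums => n; rewrite /riesz big_nil mul1r.
  have ts : H t by apply: sH; rewrite mem_head.
  have ss u : u \in s -> H u by move=> us; apply: sH; rewrite inE us orbT.
  move=> x /(orthogonal_off_raised_cos ts (IH ss og)).
  by apply: eq_bounded_sums => n; rewrite riesz_cons !mulrA.
elim: N => [|N IH]; first exact: orthogonal_off1.
by move=> x /(mulK _ IH); apply: eq_bounded_sums => n; rewrite exprS.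
Qed.

End OffSubgroup.
End BoundedSums.

(** * Bohr sets are syndetic *)

Section Recurrence.
Context {R : realType}.
Implicit Types (t u x : torus R) (m n : int) (g : int -> R).

(** Compactness of [[0, 1]] as a pigeonhole: round [g] down to a multiple of
    [1 / M]. *)
Lemma approximating_coloring g (e : R) : 0 < e ->
  (forall n, 0 <= g n <= 1) ->
  exists (T : finType) (f : int -> T), forall n m, f n = f m -> `|g n - g m| <= e.
Proof.
move=> e0 g01; have [M eM] : exists M : nat, e^-1 < M%:R.
  by exists (Num.bound e^-1); apply: archi_boundP; rewrite invr_ge0 ltW.
have M0 : 0 < M%:R :> R by rewrite (lt_trans _ eM) // invr_gt0.
pose f n := inord (Num.truncn (M%:R * g n)) : 'I_M.+1.
have Mg0 n : 0 <= M%:R * g n by apply: mulr_ge0 (ltW M0) _; have /andP[] := g01 n.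
have fE n : f n = Num.truncn (M%:R * g n) :> nat.
  rewrite /f inordK // ltnS -(ler_nat R).
  rewrite (le_trans (_ : _ <= M%:R * g n)) ?truncn_le //.
  by apply: ler_piMr (ltW M0) _; have /andP[] := g01 n.
exists _, f => n m /(congr1 val); rewrite /= !fE => nm.
have := truncn_itv (Mg0 n); have := truncn_itv (Mg0 m); rewrite nm -natr1.
move=> /andP[m1 m2] /andP[n1 n2].
have Me : 1 < M%:R * e by rewrite -ltr_pdivrMr // mul1r.
have : `|M%:R * (g n - g m)| <= M%:R * e by rewrite mulrBr ler_norml; lra.
by rewrite normrM gtr0_norm // ler_pM2l.
Qed.

(** [1 - raised_cos (t - u)] is the squared distance between the images of [t]
    and [u] in the plane under [((1 + tcos) / 2, (1 + tsin) / 2)]; hence it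
    suffices to round both coordinates. *)
Lemma raised_cos_coloring t (e : R) : 0 < e ->
  exists (T : finType) (f : int -> T),
    forall n m, f n = f m -> 1 - raised_cos (t *~ (n - m)) <= e.
Proof.
move=> e0; pose c n := raised_cos (t *~ n); pose s n : R := (1 + tsin (t *~ n)) / 2.
have c01 n : 0 <= c n <= 1 by rewrite raised_cos_ge0 raised_cos_le1.
have s01 n : 0 <= s n <= 1.
  have := sin_geN1 (repr (t *~ n) * (pi *+ 2)).
  have := sin_le1 (repr (t *~ n) * (pi *+ 2)).
  by rewrite /s -/(tsin _); lra.
have e2 : 0 < e / 2 by lra.
have [T [f fP]] := approximating_coloring e2 c01.
have [T' [f' fP']] := approximating_coloring e2 s01.
exists (T * T')%type, (fun n => (f n, f' n)) => n m [/fP cnm /fP' snm].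
have -> : 1 - raised_cos (t *~ (n - m)) = (c n - c m) ^+ 2 + (s n - s m) ^+ 2.
  rewrite /c /s /raised_cos mulrzBr tcosB.
  by have := tcos2Dtsin2 (t *~ n); have := tcos2Dtsin2 (t *~ m); lra.
have sq (a b : R) : 0 <= a <= 1 -> 0 <= b <= 1 -> `|a - b| <= e / 2 ->
    (a - b) ^+ 2 <= e / 2.
  move=> a01 b01; apply: le_trans; rewrite -real_normK ?num_real // expr2.
  by rewrite ler_piMr // ler_norml; lra.
by have := sq _ _ (c01 n) (c01 m) cnm; have := sq _ _ (s01 n) (s01 m) snm; lra.
Qed.

(** By induction from the inequality [a * b >= a + b - 1] for [a, b <= 1]. *)
Lemma riesz_coloring (s : seq (torus R)) (e : R) : 0 < e ->
  exists (T : finType) (f : int -> T),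
    forall n m, f n = f m -> 1 - e <= riesz s (n - m).
Proof.
elim: s e => [|t s IH] e e0.
  exists unit, (fun=> tt) => n m _.
  by rewrite /riesz big_nil; lra.
have e2 : 0 < e / 2 by lra.
have [T [f fP]] := raised_cos_coloring t e2; have [T' [f' fP']] := IH _ e2.
exists (T * T')%type, (fun n => (f n, f' n)) => n m [/fP + /fP'].
rewrite riesz_cons.
move: (raised_cos_le1 (t *~ (n - m))) (riesz_le1 s (n - m)).
move: (raised_cos _) (riesz _ _) => a b a1 b1 ae be.
by have : 0 <= (1 - a) * (1 - b); [apply: mulr_ge0; lra | lra].
Qed.

(** Fix one representative of each of the finitely many colors of
    [riesz_coloring]. Subtracting from [n] the representative of its color
    moves [n] by a bounded amount and lands where the product is near 1. *)
Lemma riesz_syndetic (s : seq (torus R)) (e : R) : 0 < e ->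
  exists D : nat, forall m,
    exists2 i : nat, (i < D)%N & 1 - e <= riesz s (m + i%:Z).
Proof.
move=> e0; have [T [f fP]] := riesz_coloring s e0.
pose r c : int := xget 0 [set n | f n = c].
have rP n : f (r (f n)) = f n by exact: (@xgetPex _ 0 [set k | f k = f n]) (ex_intro _ n erefl).
pose B := \max_c `|r c|%N.
have rB c : (`|r c| <= B)%N by exact: (leq_bigmax c).
exists (B.*2.+1) => m; pose n : int := m + B%:Z.
have rn := rB (f n).
exists `|B%:Z - r (f n)|%N; first by lia.
rewrite gez0_abs; last by lia.
rewrite addrA -/n.
by apply: fP; rewrite rP.
Qed.

End Recurrence.

(** * Escaping from a subgroup along long intervals *)

Section Escape.
Context {R : realType}.
Implicit Types (t u x : torus R) (m n : int) (g : int -> R).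

Lemma isum_mem_le (F : seq int) m L :
  isum (fun n => (n \in F)%:R) m L <= (size F)%:R :> R.
Proof.
rewrite /isum -natr_sum ler_nat -big_mkcond /= sum1_card.
pose f (i : 'I_L) : int := m + i%:Z.
have fI : injective f by move=> i j /addrI [] /val_inj.
rewrite cardE -(size_map f); apply: uniq_leq_size.
  by rewrite (map_inj_uniq fI) enum_uniq.
by move=> _ /mapP[i + ->]; rewrite mem_enum.
Qed.

Lemma isum_syndetic_ge g (r : R) (D : nat) : (forall n, 0 <= g n) ->
  (forall m, exists2 i : nat, (i < D)%N & r <= g (m + i%:Z)) ->
  forall m l, r *+ l <= isum g m (l * D).
Proof.
move=> g0 gD m l; elim: l m => [|l IH] m; first by rewrite isum0.
rewrite mulSn isumD mulrS lerD //.
have [i iD /le_trans] := gD m; apply.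
by rewrite /isum (bigD1 (Ordinal iD)) //= lerDl sumr_ge0.
Qed.

Lemma raised_cos_gap (P : seq (torus R * R)) : (forall p, p \in P -> 0 < p.2) ->
  exists2 q : R, 0 < q < 1 &
    forall p t, p \in P -> p.2 <= tnorm t -> raised_cos t <= q.
Proof.
elim: P => [|p P IH] P0; first by exists (1 / 2) => //; lra.
have [p' pP|q /andP[q0 q1] qP] := IH; first by apply: P0; rewrite inE pP orbT.
have p0 : 0 < p.2 by apply: P0; rewrite mem_head.
have [q' q'1 pq'] : exists2 q' : R, q' < 1 & forall t, p.2 <= tnorm t -> raised_cos t <= q'.
  have [p2|p2] := leP p.2 (1 / 2).
    exists ((1 + cos (p.2 * (pi *+ 2))) / 2) => [|t pt].
      by have := cos2pi_lt1 p0 p2; lra.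
    rewrite /raised_cos tcos_tnorm.
    by have := ler_cos2pi (ltW p0) pt (tnorm_le_half t); lra.
  (* No [t] has [tnorm t > 1 / 2], so any bound will do. *)
  by exists 0 => [|t]; [exact: ltr01 | have := tnorm_le_half t; lra].
exists (Num.max q q') => [|u t].
  by rewrite lt_max q0 gt_max q1 q'1.
rewrite inE le_max => /predU1P[->|uP] ut; first by rewrite pq' ?orbT.
by rewrite (qP u).
Qed.

Lemma geometric_small (r e : R) : 0 <= r < 1 -> 0 < e -> exists N, r ^+ N < e.
Proof.
move=> /andP[r0 r1] e0; have : `|r| < 1 by rewrite ger0_norm.
move=> /cvg_expr /cvgrPdist_lt /(_ _ e0) [N _ /(_ N (leqnn N))] /=.
by rewrite sub0r normrN ger0_norm ?exprn_ge0 //; exists N.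
Qed.

(** Kronecker's theorem in the contrapositive: a character whose frequency [x]
    is off the subgroup [H] is not controlled by finitely many characters with
    frequencies in [H], not even on a single interval once it is long enough. *)
Lemma off_subgroup_escape (H : set (torus R)) (P : seq (torus R * R))
    (F : seq int) x :
  zmod_closed [in H] -> (forall p, p \in P -> H p.1 /\ 0 < p.2) -> ~ H x ->
  exists L : nat, forall m, exists2 i : nat, (i < L)%N &
    [/\ m + i%:Z \notin F,
        forall p, p \in P -> tnorm (p.1 *~ (m + i%:Z)) < p.2 &
        1 / 8 <= tnorm (x *~ (m + i%:Z))].
Proof.
move=> subH PH Hx.
have [q /andP[q0 q1] qP] := raised_cos_gap (fun p pP => (PH p pP).2).
pose K := riesz (map fst P).
pose Q := (1 + q) / 2.
have [D KD] : exists D : nat, forall m,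
    exists2 i : nat, (i < D)%N & Q <= K (m + i%:Z).
  have [|D KD] := @riesz_syndetic R (map fst P) ((1 - q) / 2); first by lra.
  exists D => m; have [i iD Ki] := KD m; exists i => //.
  by apply: le_trans Ki; rewrite /Q; lra.
pose c : R := cos (1 / 8 * (pi *+ 2)).
have c1 : c <= 1 by exact: cos_le1.
have c0 : 0 < c.
  by apply: cos_gt0_pihalf; rewrite [pi *+ 2]mulr2n; have := pi_gt0 R; lra.
have D0 : 0 <= D%:R :> R by [].
have Q0 : 0 < Q by rewrite /Q; lra.
(* The factor 4 leaves half of [c * Q ^+ N] once the loss [2 * D * q ^+ N] on an
   interval of length [D] is subtracted. *)
have [N qN] : exists N, 4 * D%:R * q ^+ N <= c * Q ^+ N.
  have [||N qN] := @geometric_small (q / Q) (c / (4 * D%:R + 1)).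
  - rewrite divr_ge0 ?ltW //= ltr_pdivrMr // /Q; lra.
  - by rewrite divr_gt0 //; lra.
  exists N; move: qN; rewrite expr_div_n ltr_pdivlMr; last by lra.
  rewrite mulrAC ltr_pdivrMr ?exprn_gt0 //.
  by have := exprn_ge0 N (ltW q0); lra.
have [] := @orthogonal_off_rieszX R H subH (map fst P) N _ x Hx.
  by move=> _ /mapP[p /PH[pH _] ->].
move=> C KC.
have [l lC] : exists l : nat, C + 2 * (size F)%:R < c * Q ^+ N / 2 * l%:R.
  have cQ : 0 < c * Q ^+ N / 2 by rewrite divr_gt0 // mulr_gt0 // exprn_gt0.
  exists (Num.truncn ((c * Q ^+ N / 2)^-1 * (C + 2 * (size F)%:R))).+1.
  by rewrite -(ltr_pdivrMl _ _ cQ) truncnS_gt.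
exists (l * D)%N => m; apply: contrapT => noi.
(* If there is no such [n] in the interval, the sum of [K n ^+ N * tcos (x *~ n)]
   over it is bounded below pointwise. The two subtracted terms pay for the
   points where [K n <= q] and for those in [F]. *)
have low (i : 'I_(l * D)) (n := m + i%:Z) :
    c * K n ^+ N - 2 * q ^+ N - 2 * (n \in F)%:R <= K n ^+ N * tcos (x *~ n).
  have k0 : 0 <= K n ^+ N by apply: exprn_ge0; exact: riesz_ge0.
  have k1 : K n ^+ N <= 1.
    by apply: exprn_ile1; [exact: riesz_ge0 | exact: riesz_le1].
  have t1 : - 1 <= tcos (x *~ n) by exact: cos_geN1.
  have qN0 := exprn_ge0 N (ltW q0).
  have cases : [\/ n \in F, K n <= q | c <= tcos (x *~ n)].
    have [nF|nF] := boolP (n \in F); first by constructor 1.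
    have [[p [pP pn]]|nP] := pselect (exists p, p \in P /\ p.2 <= tnorm (p.1 *~ n)).
      constructor 2; apply: le_trans (qP p _ pP pn).
      by apply: riesz_le_raised_cos; exact: map_f.
    constructor 3; rewrite tcos_tnorm; apply: ler_cos2pi => //.
    - exact: tnorm_ge0.
    - rewrite leNgt; apply/negP => xn; apply: noi; exists i => //; split=> //.
        move=> p pP; rewrite ltNge; apply/negP => pn; apply: nP.
        by exists p.
      exact: ltW.
    - by lra.
  have lowK : - K n ^+ N <= K n ^+ N * tcos (x *~ n).
    by rewrite -mulrN1 ler_wpM2l.
  have cK : c * K n ^+ N <= K n ^+ N by rewrite ler_piMl.
  case: cases => [->|Kq|ct].
  - by rewrite mulr1; lra.
  - have : K n ^+ N <= q ^+ N.
      by apply: lerXn2r Kq; rewrite ?nnegrE ?riesz_ge0 // ltW.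
    by have : 0 <= (n \in F)%:R :> R by []; lra.
  - have : c * K n ^+ N <= K n ^+ N * tcos (x *~ n).
      by rewrite mulrC ler_wpM2l.
    by have : 0 <= (n \in F)%:R :> R by []; lra.
have := KC m (l * D)%N; rewrite ler_norml => /andP[_].
apply/negP; rewrite -ltNge; apply: lt_le_trans (ler_sum _ (fun i _ => low i)).
rewrite /= !sumrB -!mulr_sumr sumr_const card_ord.
have := isum_mem_le F m (l * D); rewrite /isum.
have KN0 n : 0 <= K n ^+ N by apply: exprn_ge0; exact: riesz_ge0.
have KND n : exists2 i : nat, (i < D)%N & Q ^+ N <= K (n + i%:Z) ^+ N.
  have [i iD QK] := KD n; exists i => //.
  by apply: lerXn2r QK; rewrite ?nnegrE ?riesz_ge0 // ltW.
have := isum_syndetic_ge KN0 KND m l; rewrite /isum -[Q ^+ N *+ l]mulr_natr.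
rewrite -[_ *+ (l * D)]mulr_natr natrM.
move: (\sum_(_ < _) _) (\sum_(_ < _) _) => S1 S2.
move=> S1ge S2le.
have cS : c * (Q ^+ N * l%:R) <= c * S2 by rewrite ler_pM2l.
have lq : 4 * D%:R * q ^+ N * l%:R <= c * Q ^+ N * l%:R by rewrite ler_wpM2r.
by lra.
Qed.
End Escape.

(** * Recovering a subgroup from its ideal *)

Theorem theorem2p11 (R : realType) (a : nat -> int) (thick_a : thick a)
    (H : set (torus R)) (subgroup_H : zmod_closed [in H]) :
  H = Hsub a (Jideal H a).
Proof.
apply/seteqP; split=> [x Hx e e0|x xH].
  split=> [_ [n _ <-]|]; first by exists n.
  exists set0, [set (x, e)]; split=> //.
  - by move=> p ->.
  - by move=> _ [n /= en <-]; right; exists (x, e) => //; split=> //; exists n.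
apply: contrapT => Hx.
have e0 : 0 < 1 / 8 :> R by lra.
have [_ [F [P [/finite_seqP[F' ->] _ /finite_seqP[P' ->] PH cov]]]] := xH _ e0.
have [L LP] := off_subgroup_escape F' subgroup_H PH Hx.
have [m mL] := thick_a L; have [i iL [iF iP ix]] := LP m.
have [|n _ nE] := mL (m + i%:Z); first by rewrite lerDl ltrD2l.
have [|/= inF|[p /= pP [_ pn]]] := cov (m + i%:Z).
- by exists n => //=; rewrite nE.
- by rewrite inF in iF.
- by have := iP p pP; rewrite ltNge pn.
Qed.
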